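(* Let $L=K_1\cup\dots\cup K_\mu$ be an (oriented, possibly virtual) link with group $G(L)$. Then the nilpotent quotient group $G(L)/G(L)_3$ has a presentation with a generator $g_i$ for each $i\in\{1,\dots,\mu\}$ and the following two kinds of relations. 1. For each $i\in\{1,\dots,\mu\}$, the relation $$g_i=\left(\prod_{\substack{j=1\\ j\ne i}}^{\mu}g_j^{\ell_{j/i}(K_i,K_j)}\right)g_i\left(\prod_{\substack{j=1\\ j\neq i}}^{\mu}g_j^{\ell_{j/i}(K_i,K_j)}\right)^{-1}.$$ 2. For all $i,j,k\in\{1,\dots,\mu\}$, the relation $[g_i,[g_j,g_k]]=1$.
   Context: Links. A link diagram $D$ is an oriented virtual link diagram in $\mathbb R^2$: it is obtained from a finite union of $\mu$ oriented piecewise smooth closed curves in general position (finitely many, transverse, double-point intersections and self-intersections, called crossings), each crossing being designated classical (with over/under information) or virtual. At each classical crossing a short piece of the underpassing segment is removed on each side of the crossing; virtual crossings are circled and nothing is removed there. This cuts the curves into arcs; $A(D)$ is the set of arcs. Two diagrams are equivalent if related by a finite sequence of detour moves (affecting only virtual crossings) and classical Reidemeister moves; an equivalence class is an (oriented, virtual) link $L=K_1\cup\dots\cup K_\mu$ with components $K_i$ given by the closed curves. Writhe. At a classical crossing $c$, the writhe $w(c)$ is $+1$ if, looking along the direction of the overpassing segment, the underpassing segment crosses from right to left, and $-1$ if it crosses from left to right. For $i\ne j$, let $C_{j/i}(D)$ be the set of classical crossings at which $K_j$ passes over $K_i$; $\ell_{j/i}(K_i,K_j)=\sum_{c\in C_{j/i}(D)}w(c)$,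 a link invariant. Group. $G(L)$ is the group generated by $\{g_a\mid a\in A(D)\}$ with, at each classical crossing, the relation $g_{a_3}=g_{a_1}g_{a_2}g_{a_1}^{-1}$, where $a_1$ is the overpassing arc, and $a_2$ (resp. $a_3$) is the underpassing arc on the right (resp. left) of $a_1$ with respect to the orientation of $a_1$. (For classical $L$ this is $\pi_1(\mathbb S^3-L)$. Equivalently $G(L)$ is the associated group of the link quandle $Q(L)$.) For a group $G$ and subgroup $H$, $[g,h]=ghg^{-1}h^{-1}$ and $[G,H]$ is the subgroup generated by all $[g,h]$, $g\in G,h\in H$. The lower central series is $G_1=G$, $G_{n+1}=[G,G_n]$ for $n\geq1$. *)

(* Defs.v *)
From HB Require Import structures.
From mathcomp Require Import all_boot all_order all_algebra.
From mathcomp Require Import all_classical all_reals all_analysis.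

Set Implicit Arguments.
Unset Strict Implicit.
Unset Printing Implicit Defensive.

Import Order.TTheory GRing.Theory Num.Theory.
Import numFieldNormedType.Exports.

Local Open Scope classical_set_scope.
Local Open Scope quotient_scope.
Local Open Scope group_scope.

(* Groups here are possibly infinite, hence based on [groupType] of
   [mathcomp.boot.monoid] rather than on [finGroupType]. *)

Definition expgz (G : groupType) (x : G) (n : int) : G :=
  match n with
  | Posz m => x ^+ m
  | Negz m => x ^- m.+1
  end.

(* This is g h g^-1 h^-1, whereas MathComp's [~ g, h] is g^-1 h^-1 g h. *)
Definition comm (G : groupType) (g h : G) : G := g * h * g^-1 * h^-1.

Definition is_subgroup (G : groupType) (H : set G) : Prop :=
  [/\ H 1,
      forall x y, H x -> H y -> H (x * y) &
      forall x, H x -> H x^-1].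

Definition is_normal (G : groupType) (N : set G) : Prop :=
  is_subgroup N /\ forall g x, N x -> N (g * x * g^-1).

Definition generated (G : groupType) (A : set G) : set G :=
  smallest (@is_subgroup G) A.

Definition commutator (G : groupType) (H K : set G) : set G :=
  generated [set z | exists2 h, H h & exists2 k, K k & z = comm h k].

(* Indexed from 1: [lcs G 1] is G, and [lcs G 0] is a junk value. *)
Fixpoint lcs (G : groupType) (n : nat) {struct n} : set G :=
  match n with
  | (_.+1 as m).+1 => commutator [set: G] (@lcs G m)
  | _ => [set: G]
  end.
Arguments lcs : clear implicits.

Record normalSubgroup (G : groupType) := NormalSubgroup {
  nsub : set G;
  nsubP : is_normal nsub
}.

Section NormalSubgroups.
Variable G : groupType.
Implicit Types A N : set G.

Lemma generated_subgroup A : is_subgroup (generated A).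
Proof.
split=> [H [[]]//|x y Ax Ay H HA|x Ax H HA].
  by case: (HA) => [[_ HM _] _]; apply: HM; [apply: Ax | apply: Ay].
by case: (HA) => [[_ _ HV] _]; apply: HV; apply: Ax.
Qed.

Lemma commutator_normal N : is_normal N -> is_normal (commutator setT N).
Proof.
move=> [_ NJ]; split; first exact: generated_subgroup.
move=> g x Cx.
have /(_ [set y | commutator setT N (g * y * g^-1)]) := Cx.
apply; split.
  have [C1 CM CV] := generated_subgroup
    [set z | exists2 h, setT h & exists2 k, N k & z = comm h k].
  split=> /=.
  - by rewrite mulg1 mulgV.
  - move=> y z Cy Cz; suff -> : g * (y * z) * g^-1 =
      (g * y * g^-1) * (g * z * g^-1) by exact: CM.
    by rewrite !mulgA mulgVK.
  - move=> y Cy; suff -> : g * y^-1 * g^-1 = (g * y * g^-1)^-1 by exact: CV.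
    by rewrite !invgM invgK mulgA.
move=> _ [h _ [k Nk ->]] /= H [_]; apply.
exists (g * h * g^-1) => //; exists (g * k * g^-1); first exact: NJ.
by rewrite /comm !invgM !invgK !mulgA !mulgVK.
Qed.

Lemma setT_normal : is_normal [set: G].
Proof. by []. Qed.

Lemma lcs_normal n : is_normal (lcs G n).
Proof.
elim: n => [|[|n] IHn]; [exact: setT_normal.. | exact: commutator_normal].
Qed.

Lemma normal_closure_subproof A : is_normal (smallest (@is_normal G) A).
Proof.
split; first split.
- by move=> H [[[]]].
- move=> x y Ax Ay H HA; case: (HA) => [[[_ HM _] _] _].
  by apply: HM; [apply: Ax | apply: Ay].
- by move=> x Ax H HA; case: (HA) => [[[_ _ HV] _] _]; apply: HV; apply: Ax.
- by move=> g x Ax H HA; case: (HA) => [[_ HJ] _]; apply: HJ; apply: Ax.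
Qed.

Definition lcs_nsub (n : nat) : normalSubgroup G :=
  NormalSubgroup (lcs_normal n).

Definition normal_closure A : normalSubgroup G :=
  NormalSubgroup (normal_closure_subproof A).

End NormalSubgroups.

Section Quotient.
Variables (G : groupType) (N : normalSubgroup G).

Definition coset_eq (x y : G) : bool := `[< nsub N (x^-1 * y) >].

Lemma coset_eq_equiv : equiv_class_of coset_eq.
Proof.
have [[S1 SM SV] _] := nsubP N; split.
- by move=> x; apply/asboolP; rewrite mulVg.
- move=> x y; apply/asboolP/asboolP => /SV; by rewrite invgM invgK.
- move=> y x z /asboolP xy /asboolP yz; apply/asboolP.
  by have := SM _ _ xy yz; rewrite mulgA mulgK.
Qed.

Canonical coset_eq_rel := EquivRelPack coset_eq_equiv.

Definition quotient_group := {eq_quot coset_eq_rel}.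
HB.instance Definition _ := Choice.on quotient_group.
HB.instance Definition _ := EqQuotient.on quotient_group.

Definition quotient_proj (x : G) : quotient_group := \pi_(quotient_group) x.

Lemma quotient_projP x y :
  quotient_proj x = quotient_proj y <-> nsub N (x^-1 * y).
Proof.
split=> [/eqP|Nxy]; first by rewrite /quotient_proj eqmodE => /asboolP.
by apply/eqP; rewrite /quotient_proj eqmodE; apply/asboolP.
Qed.

Definition quotient_mul (a b : quotient_group) : quotient_group :=
  quotient_proj (repr a * repr b).
Definition quotient_inv (a : quotient_group) : quotient_group :=
  quotient_proj (repr a)^-1.

Lemma quotient_reprK a : quotient_proj (repr a) = a.
Proof. exact: reprK. Qed.

Lemma quotient_repr x : nsub N (x^-1 * repr (quotient_proj x)).
Proof. by apply/quotient_projP; rewrite quotient_reprK. Qed.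

Lemma quotient_projM x y :
  quotient_proj (x * y) = quotient_mul (quotient_proj x) (quotient_proj y).
Proof.
apply/quotient_projP.
have := quotient_repr x; have := quotient_repr y.
move: (repr _) (repr _) => y' x' yy xx.
case: (nsubP N) => [[_ SM _] SJ].
have := SM _ _ (SJ y^-1 _ xx) yy.
by rewrite !mulgA invgK mulgK invgM.
Qed.

Lemma quotient_projV x :
  quotient_proj x^-1 = quotient_inv (quotient_proj x).
Proof.
apply/quotient_projP; have := quotient_repr x; move: (repr _) => x' xx.
case: (nsubP N) => [[_ _ SV] SJ].
by have := SJ x _ (SV _ xx); rewrite invgM !invgK !mulgA mulgK.
Qed.

Lemma quotient_mulA : associative quotient_mul.
Proof.
move=> a b c.
rewrite -(quotient_reprK a) -(quotient_reprK b) -(quotient_reprK c).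
by rewrite -!quotient_projM mulgA.
Qed.

Lemma quotient_mul1 : left_id (quotient_proj 1) quotient_mul.
Proof. by move=> a; rewrite -(quotient_reprK a) -quotient_projM mul1g. Qed.

Lemma quotient_mulr1 : right_id (quotient_proj 1) quotient_mul.
Proof. by move=> a; rewrite -(quotient_reprK a) -quotient_projM mulg1. Qed.

Lemma quotient_mulV : left_inverse (quotient_proj 1) quotient_inv quotient_mul.
Proof.
move=> a; rewrite -(quotient_reprK a) -quotient_projV -quotient_projM.
by rewrite mulVg.
Qed.

Lemma quotient_mulrV :
  right_inverse (quotient_proj 1) quotient_inv quotient_mul.
Proof.
move=> a; rewrite -(quotient_reprK a) -quotient_projV -quotient_projM.
by rewrite mulgV.
Qed.

HB.instance Definition _ := isGroup.Build quotient_group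
  quotient_mulA quotient_mul1 quotient_mulr1 quotient_mulV quotient_mulrV.

End Quotient.

Section FreeGroup.
Variable X : choiceType.

(* A letter (x, false) stands for x and (x, true) for its inverse. *)
Definition word : Type := seq (X * bool).

Inductive free_eqv : word -> word -> Prop :=
| free_refl w : free_eqv w w
| free_sym w1 w2 : free_eqv w1 w2 -> free_eqv w2 w1
| free_trans w1 w2 w3 :
    free_eqv w1 w2 -> free_eqv w2 w3 -> free_eqv w1 w3
| free_cancel u v x b :
    free_eqv (u ++ (x, b) :: (x, ~~ b) :: v) (u ++ v).

Definition word_inv (w : word) : word := rev [seq (l.1, ~~ l.2) | l <- w].

Definition free_eqb (u v : seq (X * bool)) : bool := `[< free_eqv u v >].

Lemma free_eqb_equiv : equiv_class_of free_eqb.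
Proof.
split.
- by move=> w; apply/asboolP; apply: free_refl.
- by move=> u v; apply/asboolP/asboolP; apply: free_sym.
- move=> v u w /asboolP uv /asboolP vw; apply/asboolP.
  exact: free_trans uv vw.
Qed.

Canonical free_eq_rel := EquivRelPack free_eqb_equiv.

Definition free_group := {eq_quot free_eq_rel}.
HB.instance Definition _ := Choice.on free_group.
HB.instance Definition _ := EqQuotient.on free_group.

Definition free_class (w : word) : free_group := \pi_(free_group) w.

Lemma free_classP u v : free_class u = free_class v <-> free_eqv u v.
Proof.
split=> [/eqP|uv]; first by rewrite /free_class eqmodE => /asboolP.
by apply/eqP; rewrite /free_class eqmodE; apply/asboolP.
Qed.

Lemma free_eqv_cat u u' v v' :
  free_eqv u u' -> free_eqv v v' -> free_eqv (u ++ v) (u' ++ v').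
Proof.
move=> uu vv; apply: (@free_trans _ (u' ++ v)).
  elim: uu => {u u' v' vv} [w|w1 w2 _|w1 w2 w3 _ IH1 _|u w x b].
  - exact: free_refl.
  - exact: free_sym.
  - exact: free_trans.
  - by rewrite -!catA; apply: free_cancel.
elim: vv => {u uu v v'} [w|w1 w2 _|w1 w2 w3 _ IH1 _|u w x b].
- exact: free_refl.
- exact: free_sym.
- exact: free_trans.
- by rewrite !catA; apply: free_cancel.
Qed.

Lemma free_eqv_inv u v : free_eqv u v -> free_eqv (word_inv u) (word_inv v).
Proof.
elim=> {u v} [w|w1 w2 _|w1 w2 w3 _ IH1 _|u w x b].
- exact: free_refl.
- exact: free_sym.
- exact: free_trans.
- rewrite /word_inv !map_cat !rev_cat /= !rev_cons -!cats1 -!catA /= negbK.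
  exact: free_cancel.
Qed.

Lemma free_eqv_mulV w : free_eqv (word_inv w ++ w) [::].
Proof.
elim: w => [|[x b] w IHw]; first exact: free_refl.
rewrite /word_inv /= rev_cons -cats1 -catA /=.
apply: free_trans IHw; rewrite -{2}[b]negbK; exact: free_cancel.
Qed.

Lemma word_invK : involutive word_inv.
Proof.
move=> w; rewrite /word_inv map_rev revK -map_comp -[RHS]map_id.
by apply: eq_map => -[x b] /=; rewrite negbK.
Qed.

Definition free_mul (a b : free_group) : free_group :=
  free_class (repr a ++ repr b).
Definition free_inv (a : free_group) : free_group :=
  free_class (word_inv (repr a)).

Lemma free_reprK a : free_class (repr a) = a.
Proof. exact: reprK. Qed.

Lemma free_repr w : free_eqv w (repr (free_class w)).
Proof. by apply/free_classP; rewrite free_reprK. Qed.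

Lemma free_classM u v :
  free_class (u ++ v) = free_mul (free_class u) (free_class v).
Proof. by apply/free_classP/free_eqv_cat; apply: free_repr. Qed.

Lemma free_classV u : free_class (word_inv u) = free_inv (free_class u).
Proof. by apply/free_classP/free_eqv_inv; apply: free_repr. Qed.

Lemma free_mulA : associative free_mul.
Proof.
move=> a b c; rewrite -(free_reprK a) -(free_reprK b) -(free_reprK c).
by rewrite -!free_classM catA.
Qed.

Lemma free_mul1 : left_id (free_class [::]) free_mul.
Proof. by move=> a; rewrite -(free_reprK a) -free_classM. Qed.

Lemma free_mulr1 : right_id (free_class [::]) free_mul.
Proof. by move=> a; rewrite -(free_reprK a) -free_classM cats0. Qed.

Lemma free_mulV : left_inverse (free_class [::]) free_inv free_mul.
Proof.
move=> a; rewrite -(free_reprK a) -free_classV -free_classM.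
exact/free_classP/free_eqv_mulV.
Qed.

Lemma free_mulrV : right_inverse (free_class [::]) free_inv free_mul.
Proof.
move=> a; rewrite -(free_reprK a) -free_classV -free_classM.
apply/free_classP; rewrite -{1}[repr a]word_invK; exact: free_eqv_mulV.
Qed.

HB.instance Definition _ := isGroup.Build free_group
  free_mulA free_mul1 free_mulr1 free_mulV free_mulrV.

Definition free_gen (x : X) : free_group := free_class [:: (x, false)].

End FreeGroup.

Section Presentations.
Variables (X : choiceType).

(* The group < X | u = v for all (u, v) in rels >. *)
Definition presented_group (rels : set (free_group X * free_group X)) :
    groupType :=
  quotient_group (normal_closure [set r.1 * r.2^-1 | r in rels]).

Definition has_presentation (G : groupType)
    (rels : set (free_group X * free_group X)) : Prop :=
  exists f : {multiplicative presented_group rels -> G}, bijective f.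

End Presentations.

Local Open Scope ring_scope.

Section Curves.
Variable R : realType.

Definition smooth (f : R -> R) : Prop :=
  forall (n : nat) (t : R), derivable (derive1n n f) t 1.

(* On each closed piece the curve extends to a smooth map; for a curve of
   period 1 this entails continuity on all of R. *)
Definition piecewise_smooth (gam : R -> R * R) : Prop :=
  exists (n : nat) (a : nat -> R),
    [/\ a 0%N = 0, a n = 1,
        forall k, (k < n)%N -> a k < a k.+1 &
        forall k, (k < n)%N -> exists g : R -> R * R,
          [/\ smooth (fst \o g), smooth (snd \o g) &
              forall t, a k <= t <= a k.+1 -> gam t = g t]].

Definition differentiable_at (gam : R -> R * R) (t : R) : Prop :=
  derivable (fst \o gam) t 1 /\ derivable (snd \o gam) t 1.

Definition velocity (gam : R -> R * R) (t : R) : R * R :=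
  (derive1 (fst \o gam) t, derive1 (snd \o gam) t).

Definition det2 (u v : R * R) : R := u.1 * v.2 - u.2 * v.1.

Variable mu : nat.

(* Closed curves are 1-periodic maps R -> R^2. A passage (i, t) with
   0 <= t < 1 is the point of the i-th parameter circle with parameter t; a
   double point is an ordered pair of distinct passages with the same image,
   so that every crossing occurs as two such pairs. *)
Definition double_points (gam : 'I_mu -> R -> R * R) :
    set (('I_mu * R) * ('I_mu * R)) :=
  [set c | [/\ 0 <= c.1.2 < 1, 0 <= c.2.2 < 1, c.1 <> c.2 &
               gam c.1.1 c.1.2 = gam c.2.1 c.2.2]].

End Curves.

(* A crossing is designated classical by putting in [classical] exactly one
   of its two ordered pairs of passages, namely (overpassing, underpassing);
   crossings with neither pair in [classical] are virtual. *)
Record link_diagram (R : realType) (mu : nat) := LinkDiagram {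
  curve : 'I_mu -> R -> R * R;
  classical : set (('I_mu * R) * ('I_mu * R));
  curve_closed : forall i t, curve i (t + 1) = curve i t;
  curve_smooth : forall i, piecewise_smooth (curve i);
  double_finite : finite_set (double_points curve);
  double_only : forall p q r,
    double_points curve (p, q) -> double_points curve (p, r) -> q = r;
  double_transverse : forall p q, double_points curve (p, q) ->
    [/\ differentiable_at (curve p.1) p.2,
        differentiable_at (curve q.1) q.2 &
        det2 (velocity (curve p.1) p.2) (velocity (curve q.1) q.2) != 0];
  classical_double : classical `<=` double_points curve;
  classical_asym : forall p q, classical (p, q) -> ~ classical (q, p)
}.

Section LinkGroup.
Variables (R : realType) (mu : nat) (D : link_diagram R mu).
Implicit Types (c : ('I_mu * R) * ('I_mu * R)).

(* The underpassing segment crosses from right to left iff the pair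
   (overpassing velocity, underpassing velocity) is positively oriented. *)
Definition writhe c : int :=
  sgz (det2 (velocity (curve D c.1.1) c.1.2)
            (velocity (curve D c.2.1) c.2.2)).

Definition crossings_over (j i : 'I_mu) :
    set (('I_mu * R) * ('I_mu * R)) :=
  [set c | [/\ classical D c, c.1.1 = j & c.2.1 = i]].

(* [linking j i] is l_{j/i}(K_i, K_j). *)
Definition linking (j i : 'I_mu) : int :=
  \sum_(c \in crossings_over j i) writhe c.

(* The lifts to R of the parameters of K_i that are not underpassing. *)
Definition uncut (i : 'I_mu) : set R :=
  [set t | forall o s (k : int), classical D (o, (i, s)) -> t <> s + k%:~R].

(* An arc is taken in the parameter circles, since in the plane arcs may meet
   at virtual crossings; it is represented by the 1-periodic set of all the
   lifts of its parameters. *)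
Definition arc_through (i : 'I_mu) (t : R) : set ('I_mu * R) :=
  [set p | p.1 = i /\
     exists k : int, connected_component (uncut i) t (p.2 + k%:~R)].

Definition arcs : set (set ('I_mu * R)) :=
  [set a | exists i t, uncut i t /\ a = arc_through i t].

Definition arc_over c (a : arcs) : Prop := set_val a c.1.

Definition arc_in c (a : arcs) : Prop :=
  \forall e \near 0^'+, set_val a (c.2.1, c.2.2 - e).

Definition arc_out c (a : arcs) : Prop :=
  \forall e \near 0^'+, set_val a (c.2.1, c.2.2 + e).

Definition arc_right c (a : arcs) : Prop :=
  if writhe c == 1 then arc_in c a else arc_out c a.

Definition arc_left c (a : arcs) : Prop :=
  if writhe c == 1 then arc_out c a else arc_in c a.

Definition link_rels : set (free_group arcs * free_group arcs) :=
  [set r | exists c (a1 a2 a3 : arcs),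
     [/\ classical D c, arc_over c a1, arc_right c a2, arc_left c a3 &
         r = (free_gen a3,
              free_gen a1 * free_gen a2 * (free_gen a1)^-1)%g]].

Definition link_group : groupType := presented_group link_rels.

End LinkGroup.

(* Main.v *)
Require Import Defs.
From HB Require Import structures.
From mathcomp Require Import all_boot all_order all_algebra.
From mathcomp Require Import all_classical all_reals all_analysis.

(** In a group of nilpotency class two, conjugation by [x] depends only on [x]
    modulo the centre, and conjugations commute with one another.  So in such a
    quotient of the link group the arcs of one component, being conjugate, all
    conjugate alike, and when a strand of [K_i] passes under [K_j] with writhe
    [w], its meridian is conjugated by the [w]-th power of any meridian of
    [K_j]; for [j = i] this changes nothing.  Hence the meridian at parameter
    [t] of [K_i] is the conjugate of a base meridian [y_i] by
    [\prod_(j != i) y_j ^ n_j], where [n_j] is the writhe-weighted number of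
    passages of [K_i] under [K_j] between the base point and [t]
    ([meridian_winding]).  After one turn [n_j] is the linking number and the
    meridian is again [y_i], which is the first family of relations
    ([longitude_relation]).

    Conversely, in a class two group whose generators [g_i] satisfy that family,
    conjugating [g_i] by [\prod_(j != i) g_j ^ n_j] at parameter [t] gives a
    function that is constant along arcs and periodic, and it satisfies the
    relations at the crossings ([winding_wirtinger]).  The two
    constructions are inverse to each other on generators.

    The counts [n_j] are sums of terms [w * floor (t - s)] over the underpasses
    [s], so they are defined on the whole line, they jump by [w] exactly at the
    lifts of [s], and adding 1 to [t] adds the linking number.  A quantity that
    is locally constant off the underpasses and has equal limits on the two
    sides of each of them is constant by connectedness of the line
    ([circle_constant]). *)

Set Implicit Arguments.
Unset Strict Implicit.
Unset Printing Implicit Defensive.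

Import Order.TTheory GRing.Theory Num.Theory.
Import numFieldNormedType.Exports.

Local Open Scope classical_set_scope.
Local Open Scope group_scope.

(** * Morphisms out of presented groups and quotients *)

Section QuotientLift.
Variables (G H : groupType) (N : normalSubgroup G).

HB.instance Definition _ :=
  isGroupMorphism.Build G (quotient_group N) (@quotient_proj G N)
    (fun x y => etrans (quotient_projM N x y^-1)
                  (congr1 (quotient_mul _) (quotient_projV N y))).

Variables (f : UMagmaMorphism.type G H).
Hypothesis fN1 : forall x, nsub N x -> f x = 1.

Let lift (a : quotient_group N) : H := f (repr a).

Let liftE x : lift (quotient_proj N x) = f x.
Proof.
have /fN1 := quotient_repr N x; rewrite gmulfM gmulfV => /mulg1_eq.
by rewrite invgK.
Qed.

Let lift_morph : {morph lift : x y / x / y}.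
Proof.
move=> x y; rewrite -(quotient_reprK x) -(quotient_reprK y) -gmulfF !liftE.
by rewrite gmulfF.
Qed.

HB.instance Definition _ := isGroupMorphism.Build _ _ lift lift_morph.

Lemma quotient_lift : exists h : UMagmaMorphism.type (quotient_group N) H,
  forall x, h (quotient_proj N x) = f x.
Proof. by exists lift; apply: liftE. Qed.

End QuotientLift.

Section FreeLift.
Variables (X : choiceType) (H : groupType) (h : X -> H).

Let eval (w : word X) : H := \prod_(l <- w) (if l.2 then (h l.1)^-1 else h l.1).

Let eval_eqv u v : free_eqv u v -> eval u = eval v.
Proof.
rewrite /eval; elim=> {u v} [//|//|w1 w2 w3 _ -> //|u v x b].
rewrite !big_cat /= !big_cons /=; congr (_ * _).
by case: b; rewrite /= ?mulVKg ?mulKg.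
Qed.

Let lift (a : free_group X) : H := eval (repr a).

Let liftE w : lift (free_class w) = eval w.
Proof. exact/esym/eval_eqv/free_repr. Qed.

Let eval_inv w : eval (word_inv w) = (eval w)^-1.
Proof.
rewrite /eval; elim: w => [|[x b] w IHw]; first by rewrite !big_nil invg1.
rewrite /word_inv /= rev_cons -cats1 big_cat big_seq1 /= IHw big_cons invgM /=.
by case: b; rewrite ?invgK.
Qed.

Let lift_morph : {morph lift : x y / x / y}.
Proof.
move=> x y; rewrite -(free_reprK x) -(free_reprK y).
move: (repr x) (repr y) => {x y} u v.
have -> : free_class u / free_class v = free_class (u ++ word_inv v).
  by rewrite free_classM free_classV.
by rewrite !liftE -eval_inv /eval big_cat.
Qed.

HB.instance Definition _ := isGroupMorphism.Build _ _ lift lift_morph.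

Lemma free_lift : exists f : UMagmaMorphism.type (free_group X) H,
  forall x, f (free_gen x) = h x.
Proof.
by exists lift => x; apply: etrans (liftE _) _; rewrite /eval big_seq1.
Qed.

Lemma free_group_ind (P : set (free_group X)) :
  is_subgroup P -> (forall x, P (free_gen x)) -> forall a, P a.
Proof.
move=> [P1 PM PV] PX a; rewrite -(free_reprK a).
elim: (repr a) => [//|[x b] w IHw]; rewrite -cat1s free_classM.
apply: PM IHw; case: b; last exact: PX.
by have := PV _ (PX x); rewrite [_^-1](_ : _ = free_class [:: (x, true)])
  // -[RHS]/(free_class (word_inv [:: (x, false)])) free_classV.
Qed.

End FreeLift.

Section Presented.
Variables (X : choiceType) (rels : set (free_group X * free_group X)).

Let N := normal_closure [set r.1 * r.2^-1 | r in rels].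

Definition presented_gen (x : X) : presented_group rels :=
  quotient_proj N (free_gen x).

Definition presented_proj :
  UMagmaMorphism.type (free_group X) (presented_group rels) :=
  quotient_proj N.

Lemma presented_rel r : rels r -> presented_proj r.1 = presented_proj r.2.
Proof.
move=> rr; apply/divg1_eq; have <- : presented_proj 1 = 1 by exact: gmulf1.
rewrite -gmulfF; apply/esym/quotient_projP; rewrite invg1 mul1g => M [_]; apply.
by exists r.
Qed.

Lemma presented_ind (P : set (presented_group rels)) :
  is_subgroup P -> (forall x, P (presented_gen x)) -> forall a, P a.
Proof.
move=> [P1 PM PV] PX a; rewrite -(quotient_reprK a).
apply: (@free_group_ind X (fun b => P (presented_proj b))) => //; split.
- by rewrite gmulf1.
- by move=> x y Px Py; rewrite gmulfM; apply: PM.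
- by move=> x Px; rewrite gmulfV; apply: PV.
Qed.

Variables (H : groupType).

Lemma presented_ext (u v : UMagmaMorphism.type (presented_group rels) H) :
  (forall x, u (presented_gen x) = v (presented_gen x)) -> u =1 v.
Proof.
move=> uv; apply: presented_ind uv; split=> [|a b ua ub|a ua].
- by rewrite !gmulf1.
- by rewrite !gmulfM ua ub.
- by rewrite !gmulfV ua.
Qed.

Lemma presented_lift (f : UMagmaMorphism.type (free_group X) H) :
    (forall r, rels r -> f r.1 = f r.2) ->
  exists h : UMagmaMorphism.type (presented_group rels) H,
    forall x, h (presented_gen x) = f (free_gen x).
Proof.
move=> fr; have [|h hE] := @quotient_lift _ _ N f; last first.
  by exists h => x; rewrite hE.
move=> x Nx; apply: (Nx [set y | f y = 1]); split; last first.
  by move=> _ [r rr <-] /=; rewrite gmulfF fr // mulgV.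
split; last by move=> g y /= fy; rewrite !gmulfM fy mulg1 gmulfV mulgV.
by split=> /= [|a b fa fb|a fa]; rewrite ?gmulf1 ?gmulfM ?gmulfV ?fa ?fb
  ?mulg1 ?invg1.
Qed.

End Presented.

(** * Groups of nilpotency class two *)

Definition class_two (G : groupType) : Prop :=
  forall x y z : G, comm x (comm y z) = 1.

Definition gconj (G : groupType) (y x : G) : G := y * x * y^-1.

(** Equality modulo the centre, in the form in which it is used. *)
Definition same_conj (G : groupType) (x y : G) : Prop := gconj x =1 gconj y.

Section Groups.
Variable G : groupType.
Implicit Types x y z u : G.

Lemma comm_gconj x y : comm x y = gconj x y * y^-1.
Proof. by []. Qed.

Lemma gconj_comm x y : gconj x y = comm x y * y.
Proof. by rewrite comm_gconj mulgVK. Qed.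

Lemma comm1P x y : comm x y = 1 <-> gconj x y = y.
Proof.
rewrite comm_gconj; split=> [/divg1_eq //|->]; exact: mulgV.
Qed.

Lemma commV x y : (comm x y)^-1 = comm y x.
Proof. by rewrite /comm !invgM !invgK !mulgA. Qed.

Lemma gconjM x y u : gconj (x * y) u = gconj x (gconj y u).
Proof. by rewrite /gconj invgM !mulgA. Qed.

Lemma gconjMr x y z : gconj x (y * z) = gconj x y * gconj x z.
Proof. by rewrite /gconj !mulgA mulgVK. Qed.

Lemma gconj1 u : gconj 1 u = u.
Proof. by rewrite /gconj mul1g invg1 mulg1. Qed.

Lemma gconjg1 x : gconj x 1 = 1.
Proof. by rewrite /gconj mulg1 mulgV. Qed.

Lemma gconjVr x y : gconj x y^-1 = (gconj x y)^-1.
Proof. by rewrite /gconj !invgM invgK mulgA. Qed.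

Lemma gconjK x : cancel (gconj x) (gconj x^-1).
Proof. by move=> u; rewrite -gconjM mulVg gconj1. Qed.

Lemma gconjVK x : cancel (gconj x^-1) (gconj x).
Proof. by move=> u; rewrite -gconjM mulgV gconj1. Qed.

Lemma gconjxx x : gconj x x = x.
Proof. exact: mulgK. Qed.

Lemma same_conjM x x' y y' :
  same_conj x x' -> same_conj y y' -> same_conj (x * y) (x' * y').
Proof. by move=> xx yy u; rewrite !gconjM xx yy. Qed.

Lemma same_conjV x y : same_conj x y -> same_conj x^-1 y^-1.
Proof. by move=> xy u; rewrite -{1}[u](gconjVK y) -xy gconjK. Qed.

Lemma same_conj_expgz x y n :
  same_conj x y -> same_conj (expgz x n) (expgz y n).
Proof.
have pos m : same_conj x y -> same_conj (x ^+ m) (y ^+ m).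
  by move=> xy; elim: m => [//|m IHm]; rewrite !expgS; apply: same_conjM.
by case: n => m xy; [apply: pos | apply/same_conjV/pos].
Qed.

Lemma expgzS x n : expgz x (n + 1)%R = expgz x n * x.
Proof.
case: n => [n|[|n]]; first by rewrite -PoszD addn1 /= expgSr.
  by rewrite [(_ + _)%R](_ : _ = 0%R) //= expg0 expg1 mulVg.
rewrite [(_ + _)%R](_ : _ = Negz n) /=; last first.
  by rewrite !NegzE -(addn1 n.+1) PoszD opprD subrK.
by rewrite [in RHS]expgS invgM mulgVK.
Qed.

Lemma expgzD x m n : expgz x (m + n)%R = expgz x m * expgz x n.
Proof.
elim/int_rect: n => [|n IHn|n IHn]; first by rewrite addr0 /= expg0 mulg1.
  by rewrite -addn1 PoszD addrA !expgzS IHn mulgA.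
apply: (@mulIg _ x); rewrite -mulgA -!expgzS -addrA.
by rewrite -(addn1 n) PoszD opprD subrK.
Qed.

Lemma gconj_expgz x n : gconj (expgz x n) x = x.
Proof.
have pos m : gconj (x ^+ m) x = x.
  elim: m => [|m IHm]; first by rewrite expg0 gconj1.
  by rewrite expgSr gconjM gconjxx.
by case: n => m //=; rewrite -{2}(pos m.+1) gconjK.
Qed.

Hypothesis G2 : class_two G.

Lemma gconj_central x y u : gconj (comm x y) u = u.
Proof.
have /comm1P := G2 u x y; rewrite /gconj => /(congr1 ( *%g^~ u)).
by rewrite mulgVK => <-; rewrite mulgK.
Qed.

Lemma same_conj_gconj x y : same_conj (gconj x y) y.
Proof. by move=> u; rewrite [gconj x y]gconj_comm gconjM gconj_central. Qed.

Lemma gconjC x y u : gconj x (gconj y u) = gconj y (gconj x u).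
Proof.
by rewrite -gconjM -[x * y](mulgVK x) -/(gconj x y) gconjM same_conj_gconj.
Qed.

End Groups.

Lemma gmulf_expgz (G H : groupType) (f : UMagmaMorphism.type G H) x n :
  f (expgz x n) = expgz (f x) n.
Proof. by case: n => n /=; rewrite ?gmulfXVn ?gmulfXn. Qed.

Lemma gmulf_gconj (G H : groupType) (f : UMagmaMorphism.type G H) x y :
  f (gconj x y) = gconj (f x) (f y).
Proof. by rewrite !gmulfM gmulfV. Qed.

Lemma gmulf_comm (G H : groupType) (f : UMagmaMorphism.type G H) x y :
  f (comm x y) = comm (f x) (f y).
Proof. by rewrite !gmulfM !gmulfV. Qed.

(** Commutators with a fixed element, when central, multiply: from
    [comm (x * y) c = gconj x (comm y c) * comm x c] the elements [x] for which
    [comm x c] is central form a subgroup.  This lets each of the three slots of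
    [comm x (comm y z)] be extended in turn from the generators to the group. *)
Lemma generated_class_two (G : groupType) (T : Type) (g : T -> G) :
    (forall P : set G, is_subgroup P -> (forall i, P (g i)) -> forall x, P x) ->
    (forall i j k, comm (g i) (comm (g j) (g k)) = 1) ->
  class_two G.
Proof.
move=> gen g2; pose central z := forall x : G, gconj x z = z.
have cV z : central z -> central z^-1 by move=> cz x; rewrite gconjVr cz.
have central_gen z : (forall i, gconj (g i) z = z) -> central z.
  move=> gz; apply: gen gz; split=> [|x y xz yz|x xz]; first exact: gconj1.
    by rewrite gconjM yz.
  by rewrite -{1}xz gconjK.
have left_gen c :
    (forall i, central (comm (g i) c)) -> forall x, central (comm x c).
  move=> gc; apply: gen gc; split=> [|x y cx cy|x cx].
  - by move=> z; rewrite comm_gconj gconj1 mulgV gconjg1.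
  - rewrite comm_gconj gconjM [gconj y c]gconj_comm gconjMr cy.
    rewrite -mulgA -comm_gconj.
    by move=> z; rewrite gconjMr cx cy.
  - suff -> : comm x^-1 c = (comm x c)^-1 by apply: cV.
    by rewrite -(cx x^-1) (comm_gconj x) gconjMr gconjK gconjVr invgM invgK.
suff cc y z : central (comm y z) by move=> x y z; apply/comm1P/cc.
apply: (left_gen) => j; rewrite -commV; apply: cV.
apply: left_gen => k; apply: central_gen => i; apply/comm1P; exact: g2.
Qed.

(** The preimage of the centre contains all commutators, hence the second term
    of the series; the third term then dies. *)
Lemma lcs3_ker (G H : groupType) (f : UMagmaMorphism.type G H) x :
  class_two H -> lcs G 3 x -> f x = 1.
Proof.
move=> H2 Gx; pose Z := [set y : G | forall u, gconj u (f y) = f y].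
apply: (Gx [set y | f y = 1]); split.
  by split=> /= [|a b fa fb|a fa]; rewrite ?gmulf1 ?gmulfM ?gmulfV ?fa ?fb
    ?mulg1 ?invg1.
move=> _ [h _ [k Gk ->]] /=; rewrite gmulf_comm; apply/comm1P.
move: (f h); apply: (Gk Z); split.
  by split=> [u|a b fa fb u|a fa u]; rewrite ?gmulf1 ?gmulfM ?gmulfV
    ?gconjg1 ?gconjMr ?gconjVr ?fa ?fb.
by move=> _ [a _ [b _ ->]] u; rewrite gmulf_comm; apply/comm1P.
Qed.

Lemma quotient_lcs3 (G : groupType) : class_two (quotient_group (lcs_nsub G 3)).
Proof.
move=> x y z.
rewrite -(quotient_reprK x) -(quotient_reprK y) -(quotient_reprK z).
have <- : quotient_proj (lcs_nsub G 3) 1 = 1 by exact: gmulf1.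
have qC a b : comm (quotient_proj (lcs_nsub G 3) a) (quotient_proj _ b) =
    quotient_proj _ (comm a b) by exact/esym/gmulf_comm.
rewrite (qC (repr y) (repr z)) qC; apply/esym/quotient_projP.
rewrite invg1 mul1g /= => M [_]; apply; exists (repr x) => //;
  exists (comm (repr y) (repr z)) => //.
by move=> M' [_]; apply; exists (repr y) => //; exists (repr z).
Qed.

Section Longitude.
Variables (G : groupType) (mu : nat) (y : 'I_mu -> G).
Hypothesis G2 : class_two G.

(** A word [\prod_(j != i) y_j ^ n_j] by which the meridian of [K_i] is
    conjugated along the way.  If the [y_j] are meridians and the [n_j] the
    linking numbers, it is the longitude of [K_i] up to the centre and powers of
    [y_i]. *)
Definition longitude (i : 'I_mu) (n : 'I_mu -> int) : G :=
  \prod_(j < mu | j != i) expgz (y j) (n j).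

Lemma longitudeD i m n : same_conj (longitude i (fun j => m j + n j)%R)
  (longitude i m * longitude i n).
Proof.
rewrite /longitude; elim/big_rec3: _ => [u|j a b c _ cab u].
  by rewrite mulg1.
rewrite expgzD !gconjM cab !gconjM; congr gconj; exact: gconjC.
Qed.

Lemma longitude0 i : longitude i (fun=> 0%R) = 1.
Proof. exact: big1. Qed.

(** For [j = i] the left side conjugates by the empty product and the right side
    by a power of [y i] itself, so self-crossings need no separate treatment. *)
Lemma longitude1 i j w :
  gconj (longitude i (fun k => if k == j then w else 0%R)) (y i) =
  gconj (expgz (y j) w) (y i).
Proof.
rewrite /longitude; have [->|ji] := eqVneq j i.
  rewrite big1 ?gconj_expgz ?gconj1 // => k ki.
  by rewrite (negPf ki) /= expg0.
rewrite -big_filter.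
have eq1 k : k != j -> expgz (y k) (if k == j then w else 0%R) = 1.
  by move=> /negPf ->; rewrite /= expg0.
have: uniq [seq k <- index_enum 'I_mu | k != i].
  exact/filter_uniq/index_enum_uniq.
have: j \in [seq k <- index_enum 'I_mu | k != i].
  by rewrite mem_filter ji mem_index_enum.
(* The factors need not commute, so the one at [j] is isolated by induction on
   the list of indices. *)
move: [seq _ <- _ | _] => s.
elim: s => // k s IHs.
rewrite in_cons big_cons => /predU1P[<-|js] /= /andP[ks us].
  rewrite eqxx big_seq big1 ?mulg1 // => l ls.
  by apply: eq1; apply: contraNneq ks => <-.
rewrite eq1 ?mul1g ?IHs //; by apply: contraNneq ks => ->.
Qed.

(** The effect on the conjugated meridian of one passage of [K_i] under [K_j]
    with writhe [w]. *)
Lemma longitude_step i n j w :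
  gconj (longitude i (fun k => n k + (if k == j then w else 0))%R) (y i) =
  gconj (expgz (y j) w) (gconj (longitude i n) (y i)).
Proof. by rewrite longitudeD gconjM longitude1 // gconjC. Qed.

End Longitude.

Lemma gmulf_longitude (G H : groupType) (f : UMagmaMorphism.type G H) mu
    (y : 'I_mu -> G) i n :
  f (longitude y i n) = longitude (fun j => f (y j)) i n.
Proof. by rewrite gmulf_prod; apply: eq_bigr => j _; rewrite gmulf_expgz. Qed.

Local Open Scope ring_scope.

(** * Locally constant functions on the line *)

Section LocallyConstant.

(** The level set of the value at [x] is open and closed in [A]. *)
Lemma connected_locally_constant (T : topologicalType) (U : Type) (A : set T)
    (f : T -> U) : connected A ->
    (forall x, A x -> \forall y \near x, A y -> f y = f x) ->
  forall x y, A x -> A y -> f x = f y.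
Proof.
move=> cA fA x y Ax Ay; pose E := [set z | A z -> f z = f x].
pose E' := [set z | A z -> f z <> f x].
suff AE : A `&` [set z | f z = f x] = A by move: Ay; rewrite -AE => -[].
apply: cA; first by exists x.
- exists E^°; first exact: open_interior.
  apply/seteqP; split=> z [Az Ez]; split=> //.
    by apply: filterS (fA z Az) => w zw Aw; rewrite zw.
  exact: (interior_subset Ez).
- exists (~` E'^°); first exact/open_closedC/open_interior.
  apply/seteqP; split=> z [Az Ez]; split=> //.
    by move=> /interior_subset/(_ Az).
  apply: contrapT => fz; apply: Ez.
  by apply: filterS (fA z Az) => w zw Aw; rewrite zw.
Qed.

Variable R : realType.

Lemma near_left_right (t : R) (P : R -> Prop) :
  (\forall u \near t^'-, P u) -> (\forall u \near t^'+, P u) ->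
  \forall u \near t^', P u.
Proof.
rewrite !near_withinE => Pl Pr.
by near=> u; rewrite neq_lt => /orP[]; near: u.
Unshelve. all: by end_near. Qed.

Lemma near_left (t : R) (P : R -> Prop) :
  (\forall u \near t^', P u) -> \forall u \near t^'-, P u.
Proof.
by rewrite !near_withinE; apply: filterS => u Pu ut; apply/Pu; rewrite lt_eqF.
Qed.

Lemma near_right (t : R) (P : R -> Prop) :
  (\forall u \near t^', P u) -> \forall u \near t^'+, P u.
Proof.
by rewrite !near_withinE; apply: filterS => u Pu ut; apply/Pu; rewrite gt_eqF.
Qed.

Lemma near_punctured (t : R) (P : R -> Prop) :
  P t -> (\forall u \near t^', P u) -> \forall u \near t, P u.
Proof.
move=> Pt; rewrite near_withinE; apply: filterS => u Pu.
by have [->|/Pu] := eqVneq u t.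
Qed.

(** [F] may be arbitrary at the points outside [D]: replacing it there by its
    limit gives a locally constant function on the whole line. *)
Lemma punctured_constant (T : Type) (D : set R) (F : R -> T) :
    (forall t, D t -> \forall u \near t^', F u = F t) ->
    (forall t, ~ D t -> exists v, \forall u \near t^', F u = v) ->
  forall t u, D t -> D u -> F t = F u.
Proof.
move=> FD FnD.
have /choice[G FG] : forall t, exists v, \forall u \near t^', F u = v.
  by move=> t; have [/FD Dt|/FnD//] := pselect (D t); exists (F t).
have DG t : D t -> F t = G t.
  move=> /FD Ft; have [u [<- <-]//] : exists u, F u = F t /\ F u = G t.
  by apply: (@filter_ex _ t^'); apply: filterI Ft (FG t).
move=> t u Dt Du; rewrite !DG //.
apply: (@connected_locally_constant _ _ setT) => // [|v _].
  by apply/connected_intervalP => ? ? ? ? ? ?.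
apply: near_punctured => //.
have := FG v; rewrite !near_withinE => /nbhs_interior Fv.
apply: filterS Fv => w Fw wv _.
have [x [<- <-]//] : exists x, F x = G w /\ F x = G v.
apply: (@filter_ex _ w^'); apply: filterI; first exact: FG.
have wv' : \forall x \near w, x != v.
  by apply: open_nbhs_nbhs; split => //; exact: open_neq.
by apply: nbhs_dnbhs; apply: filterS2 Fw wv' => x; apply.
Qed.

Lemma floor_right (s t : R) :
  \forall u \near t^'+, Num.floor (u - s) = Num.floor (t - s).
Proof.
have /andP[ft tf] := floor_itv (t - s).
near=> u; apply: floor_def; rewrite (le_trans ft) /=; last first.
  by rewrite lerD2r ltW //; near: u; exact: nbhs_right_gt.
by rewrite ltrBlDr; near: u; apply: nbhs_right_lt; rewrite -ltrBlDr.
Unshelve. all: by end_near. Qed.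

Lemma floor_left (s t : R) :
  \forall u \near t^'-, Num.floor (u - s) = Num.ceil (t - s) - 1.
Proof.
have /andP[ct tc] := ceil_itv (t - s).
near=> u; apply: floor_def; rewrite subrK; apply/andP; split.
  by rewrite lerBrDr; near: u; apply: nbhs_left_ge; rewrite -ltrBrDr.
by rewrite (lt_le_trans _ tc) // ltrD2r; near: u; exact: nbhs_left_lt.
Unshelve. all: by end_near. Qed.

End LocallyConstant.

Lemma finite_near (I : choiceType) (T : Type) (F : set_system T) (A : set I)
    (P : I -> T -> Prop) : Filter F -> finite_set A ->
  (forall i, A i -> \forall x \near F, P i x) ->
  \forall x \near F, forall i, A i -> P i x.
Proof.
move=> FF /finite_fsetP[X ->] PX.
exact: (@filter_bigI _ _ X P F FF).
Qed.

(** * Underpasses and arcs of a diagram *)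

Section Diagram.
Variables (R : realType) (mu : nat) (D : link_diagram R mu).
Implicit Types (c : ('I_mu * R) * ('I_mu * R)) (i j : 'I_mu).
Implicit Types (t u : R) (k : int).

Lemma finite_classical : finite_set (classical D).
Proof. exact: sub_finite_set (@classical_double _ _ D) (double_finite D). Qed.

Lemma over_unique c c' :
  classical D c -> classical D c' -> c.2 = c'.2 -> c = c'.
Proof.
case: c c' => [p q] [p' q'] /= cc cc' eq; rewrite -{}eq in cc' *.
suff sym o : classical D (o, q) -> double_points (curve D) (q, o).
  by rewrite (double_only (sym _ cc) (sym _ cc')).
by move=> /classical_double[/= ? ? /nesym ? /esym ?].
Qed.

Lemma shift_eq0 (s s' : R) k :
  0 <= s < 1 -> 0 <= s' < 1 -> s = s' + k%:~R -> s = s'.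
Proof.
move=> s01 s'01 e; suff k0 : k = 0 by rewrite e k0 addr0.
have := @floor_def _ s 0 s01; rewrite e floorDrz ?intr_int // intrKfloor.
by rewrite (@floor_def _ s' 0 s'01) add0r.
Qed.

Lemma uncutE i t : uncut D i t <->
  forall c, classical D c -> c.2.1 = i -> t - c.2.2 \isn't a Num.int.
Proof.
split=> [ut [p [i' s]] /= cc ii|ut o s k cc tk].
  rewrite {}ii in cc; apply/negP => /intrP[k tk]; apply: (ut p s k cc).
  by rewrite -tk addrC subrK.
by have /negP := ut _ cc erefl; apply; rewrite tk addrC addKr intr_int.
Qed.

Lemma not_uncut i t : ~ uncut D i t ->
  exists c k, [/\ classical D c, c.2.1 = i & t = c.2.2 + k%:~R].
Proof.
move=> nut; apply: contrapT => nc; apply: nut => o s k cc tk; apply: nc.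
by exists (o, (i, s)), k.
Qed.

Lemma uncutD i t k : uncut D i (t + k%:~R) <-> uncut D i t.
Proof.
by rewrite !uncutE; split=> ut c cc ci; have := ut c cc ci;
  rewrite addrAC (rpredDr _ (intr_int R k)).
Qed.

Lemma near_uncut i t : \forall u \near t^', uncut D i u.
Proof.
suff : \forall u \near t^', forall c, classical D c ->
    c.2.1 = i -> u - c.2.2 \isn't a Num.int.
  by apply: filterS => u ut; apply/uncutE.
apply: finite_near finite_classical _ => c _.
apply: near_left_right; near=> u => _; apply/negP=> /intrP[k uk].
- have fu : Num.floor (u - c.2.2) = Num.ceil (t - c.2.2) - 1.
    by near: u; apply: floor_left.
  have : (Num.ceil (t - c.2.2) - 1)%:~R < u - c.2.2.
    rewrite ltrBrDr; near: u; apply: nbhs_left_gt; rewrite -ltrBrDr.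
    exact: ceilB1_lt.
  by rewrite -fu uk intrKfloor ltxx.
- have fu : Num.floor (u - c.2.2) = Num.floor (t - c.2.2).
    by near: u; apply: floor_right.
  have tu : t < u by near: u; apply: nbhs_right_gt.
  have := floor_le (t - c.2.2); rewrite -fu uk intrKfloor -uk lerD2r.
  by rewrite leNgt tu.
Unshelve. all: by end_near. Qed.

(** A double point has exactly two passages, and only one of them goes under. *)
Lemma over_uncut c : classical D c -> uncut D c.1.1 c.1.2.
Proof.
case: c => [[j t] q] cc o s k oc /= ts.
have [t01 _ _ _] := classical_double cc.
have [_ s01 no eo] := classical_double oc.
rewrite /= in t01 s01; rewrite -{s ts s01}(shift_eq0 t01 s01 ts) in oc no eo.
have qo : q = o.
  apply: double_only (classical_double cc) _.
  by have [? ? ? ?] := classical_double oc; split=> //; exact: nesym.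
by apply: classical_asym oc _; rewrite -qo.
Qed.

Lemma ex_uncut i : exists t, uncut D i t.
Proof. exact: (@filter_ex _ (0:R)^' _ _ (near_uncut i 0)). Qed.

Definition base i : R := sval (cid (ex_uncut i)).

Lemma base_uncut i : uncut D i (base i).
Proof. exact: (svalP (cid (ex_uncut i))). Qed.

Lemma component_shift i t u k : connected_component (uncut D i) t u ->
  connected_component (uncut D i) (t + k%:~R) (u + k%:~R).
Proof.
move=> [B [Bt BD cB] Bu]; exists ((fun x => x + k%:~R) @` B); last by exists u.
split; [by exists t| by move=> _ [x Bx <-]; apply/uncutD/BD|].
apply: connected_continuous_connected cB _; apply: continuous_subspaceT => x.
by apply: cvgD; [exact: cvg_id | exact: cvg_cst].
Qed.

Lemma arc_through_shift i t k :
  arc_through D i (t + k%:~R) = arc_through D i t.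
Proof.
apply/seteqP; split=> -[i' u] [/= -> [l tu]]; split=> //.
  exists (l - k); have := component_shift (- k) tu.
  by rewrite rmorphN /= addrK -addrA -rmorphN -rmorphD.
exists (l + k); have := component_shift k tu.
by rewrite -addrA -rmorphD.
Qed.

Lemma arc_through_component i t u : connected_component (uncut D i) t u ->
  arc_through D i t = arc_through D i u.
Proof. by move=> /same_connected_component tu; rewrite /arc_through tu. Qed.

Lemma base_arc_subproof i : arc_through D i (base i) \in arcs D.
Proof.
by apply/mem_set; exists i, (base i); split => //; exact: base_uncut.
Qed.

(** The arc through the parameter [t] of [K_i].  Making it total, with the base
    arc of [K_i] as value at an underpass, allows it to appear under limits. *)
Definition arc_at i t : arcs D :=
  insubd (SigSub (base_arc_subproof i) : arcs D) (arc_through D i t).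

Lemma set_val_arc_at i t :
  uncut D i t -> set_val (arc_at i t) = arc_through D i t.
Proof. by move=> ut; apply: insubdK; apply/mem_set; exists i, t. Qed.

Lemma arc_at_shift i t k : arc_at i (t + k%:~R) = arc_at i t.
Proof. by rewrite /arc_at arc_through_shift. Qed.

Lemma arcP (a : arcs D) : exists i t, uncut D i t /\ a = arc_at i t.
Proof.
have [i [t [ut at_]]] := set_mem (valP a); exists i, t; split=> //.
by apply: val_inj; rewrite at_ -set_val_arc_at.
Qed.

Lemma arc_at_inj i j t u : uncut D i t -> uncut D j u ->
    arc_at i t = arc_at j u ->
  i = j /\ exists k, connected_component (uncut D i) t (u + k%:~R).
Proof.
move=> ut uu /(congr1 set_val); rewrite !set_val_arc_at // => tu.
have : arc_through D j u (j, u).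
  by split=> //; exists 0; rewrite addr0; exact: connected_component_refl.
by rewrite -tu => -[/= -> [k]]; split=> //; exists k.
Qed.

Lemma mem_arc (a : arcs D) i t :
  set_val a (i, t) <-> uncut D i t /\ a = arc_at i t.
Proof.
split=> [|[ut ->]]; last first.
  rewrite set_val_arc_at //; split=> //; exists 0; rewrite addr0.
  exact: connected_component_refl.
have [j [u [uu ->]]] := arcP a; rewrite set_val_arc_at // => -[/= -> [k tu]].
have ut : uncut D j t.
  by apply/(uncutD _ _ k); exact: connected_component_sub tu.
split=> //; apply: val_inj; rewrite -!set_valE !set_val_arc_at //.
by rewrite (arc_through_component tu) arc_through_shift.
Qed.

Lemma arc_at_itv i (J : interval R) t u : [set` J] `<=` uncut D i ->
  t \in J -> u \in J -> arc_at i t = arc_at i u.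
Proof.
move=> JD tJ uJ; rewrite /arc_at (@arc_through_component i t u) //.
exists [set` J] => //; split => //.
exact/connected_intervalP/interval_is_interval.
Qed.

Lemma arc_at_near i t :
  uncut D i t -> \forall u \near t^', arc_at i u = arc_at i t.
Proof.
move=> ut; have : \forall u \near t, uncut D i u.
  by apply: near_punctured => //; exact: near_uncut.
move=> /nbhs_ballP[e /= e0 eD]; apply: nbhs_dnbhs; near=> u.
apply: (@arc_at_itv _ `]t - e, t + e[).
- by move=> v /= tv; apply: eD; rewrite ball_itv.
- have : ball t e u by near: u; exact: nbhsx_ballx.
  by rewrite ball_itv.
- by rewrite in_itv /= ltrDl gtrDl oppr_lt0 e0.
Unshelve. all: by end_near. Qed.

Lemma arc_left_limit i t : exists a, \forall u \near t^'-, arc_at i u = a.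
Proof.
have := near_uncut i t; rewrite near_withinE => /nbhs_ballP[e /= e0 eD].
exists (arc_at i (t - e / 2)); near=> u; apply: (@arc_at_itv _ `]t - e, t[).
- move=> v /=; rewrite in_itv /= => /andP[ev vt].
  apply: eD; last by rewrite lt_eqF.
  by rewrite ball_itv /= in_itv /= ev (lt_trans vt) // ltrDl.
- rewrite in_itv /=; apply/andP; split; near: u; last exact: nbhs_left_lt.
  by apply: nbhs_left_gt; rewrite gtrDl oppr_lt0.
- rewrite in_itv /= ltrD2l ltrN2 gtrDl oppr_lt0 divr_gt0 // andbT.
  by rewrite gtr_pMr // invf_lt1 // ltr1n.
Unshelve. all: by end_near. Qed.

Lemma arc_right_limit i t : exists a, \forall u \near t^'+, arc_at i u = a.
Proof.
have := near_uncut i t; rewrite near_withinE => /nbhs_ballP[e /= e0 eD].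
exists (arc_at i (t + e / 2)); near=> u; apply: (@arc_at_itv _ `]t, t + e[).
- move=> v /=; rewrite in_itv /= => /andP[tv ve].
  apply: eD; last by rewrite gt_eqF.
  by rewrite ball_itv /= in_itv /= ve (lt_trans _ tv) // gtrDl oppr_lt0.
- rewrite in_itv /=; apply/andP; split; near: u; first exact: nbhs_right_gt.
  by apply: nbhs_right_lt; rewrite ltrDl.
- rewrite in_itv /= ltrD2l ltrDl divr_gt0 //=.
  by rewrite gtr_pMr // invf_lt1 // ltr1n.
Unshelve. all: by end_near. Qed.

Lemma arc_overP c (a : arcs D) : classical D c ->
  arc_over c a <-> a = arc_at c.1.1 c.1.2.
Proof.
move=> cc; rewrite /arc_over; case: c cc => [[j t] q] cc; rewrite mem_arc /=.
by split=> [[]|] //; split=> //; exact: (over_uncut cc).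
Qed.

Lemma arc_inP c (a : arcs D) :
  arc_in c a <-> \forall u \near c.2.2^'-, arc_at c.2.1 u = a.
Proof.
have /near_left := near_uncut c.2.1 c.2.2; rewrite /arc_in !nbhs_left0P => un.
split=> ina; near=> e.
  by have /mem_arc[] : set_val a (c.2.1, c.2.2 - e) by near: e.
by apply/mem_arc; split; [near: e | apply/esym; near: e].
Unshelve. all: by end_near. Qed.

Lemma arc_outP c (a : arcs D) :
  arc_out c a <-> \forall u \near c.2.2^'+, arc_at c.2.1 u = a.
Proof.
have /near_right := near_uncut c.2.1 c.2.2.
rewrite /arc_out => /nbhs_right0P un.
rewrite (nbhs_right0P c.2.2).
split=> ina; near=> e.
  by have /mem_arc[] : set_val a (c.2.1, c.2.2 + e) by near: e.
by apply/mem_arc; split; [near: e | apply/esym; near: e].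
Unshelve. all: by end_near. Qed.

Lemma near_left_shift c (a : arcs D) k : arc_in c a ->
  \forall u \near (c.2.2 + k%:~R)^'-, arc_at c.2.1 u = a.
Proof.
move=> /arc_inP; rewrite !nbhs_left0P; apply: filterS => e <-.
by rewrite addrAC arc_at_shift.
Qed.

Lemma near_right_shift c (a : arcs D) k : arc_out c a ->
  \forall u \near (c.2.2 + k%:~R)^'+, arc_at c.2.1 u = a.
Proof.
move=> /arc_outP/nbhs_right0P ca; apply/nbhs_right0P; apply: filterS ca => e <-.
by rewrite addrAC arc_at_shift.
Qed.

Lemma writheP c : classical D c -> writhe D c = 1 \/ writhe D c = -1.
Proof.
case: c => p q /classical_double/double_transverse[_ _ /=].
by rewrite /writhe /=; case: sgzP => //; [left|right].
Qed.

(** * Wirtinger relations *)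

(** The relation at a crossing read along the underpassing strand rather than
    from right to left: both signs of the writhe then take the same form. *)
Definition wirtinger (G : groupType) (y : arcs D -> G) : Prop :=
  forall c a1 a2 a3, classical D c -> arc_over c a1 -> arc_in c a2 ->
  arc_out c a3 -> y a3 = gconj (expgz (y a1) (writhe D c)) (y a2).

Lemma wirtingerP (G : groupType)
    (f : UMagmaMorphism.type (free_group (arcs D)) G) :
  (forall r, @link_rels R mu D r -> f r.1 = f r.2) <->
  wirtinger (fun a => f (free_gen a)).
Proof.
split=> [fr c a1 a2 a3 cc c1 c2 c3|fw _ [c [a1 [a2 [a3 [cc c1 c2 c3 ->]]]]]] /=.
  have [w|w] := writheP cc; rewrite w /=.
    rewrite expg1 -gmulf_gconj; apply: (fr (_, _)).
    by exists c, a1, a2, a3; rewrite /arc_left /arc_right w.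
  rewrite expg1; apply: (canRL (gconjK _)); rewrite -gmulf_gconj.
  apply/esym/(fr (_, _)); exists c, a1, a3, a2.
  by rewrite /arc_left /arc_right w.
rewrite gmulf_gconj; move: c2 c3; rewrite /arc_left /arc_right.
have [w|w] := writheP cc; rewrite w /= => c2 c3.
  by rewrite (fw _ _ _ _ cc c1 c2 c3) w /= expg1.
by rewrite (fw _ _ _ _ cc c1 c3 c2) w /= expg1 gconjVK.
Qed.

(** * Counting underpasses *)

(** The term of a crossing is locally constant off the lifts of its underpass,
    jumps there by its writhe, and grows by its writhe with each turn. *)
Definition passes i t j : int :=
  \sum_(c \in crossings_over D j i) writhe D c * Num.floor (t - c.2.2).

(** The limit of [passes] from the left, as [ceil x - 1] is the value of [floor]
    just before [x]. *)
Definition passes_left i t j : int :=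
  \sum_(c \in crossings_over D j i) writhe D c * (Num.ceil (t - c.2.2) - 1).

Lemma finite_crossings j i : finite_set (crossings_over D j i).
Proof. by apply: sub_finite_set finite_classical => c []. Qed.

Lemma near_passes_right i t : \forall u \near t^'+, passes i u = passes i t.
Proof.
have : \forall u \near t^'+, forall c, classical D c ->
    Num.floor (u - c.2.2) = Num.floor (t - c.2.2).
  by apply: finite_near finite_classical _ => c _; exact: floor_right.
apply: filterS => u ut; apply/funext => j.
by apply: eq_fsbigr => c /set_mem[cc _ _]; rewrite ut.
Qed.

Lemma near_passes_left i t : \forall u \near t^'-, passes i u = passes_left i t.
Proof.
have : \forall u \near t^'-, forall c, classical D c ->
    Num.floor (u - c.2.2) = Num.ceil (t - c.2.2) - 1.
  by apply: finite_near finite_classical _ => c _; exact: floor_left.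
apply: filterS => u ut; apply/funext => j.
by apply: eq_fsbigr => c /set_mem[cc _ _]; rewrite ut.
Qed.

Lemma passes_uncut i t : uncut D i t -> passes_left i t = passes i t.
Proof.
move=> /uncutE ut; apply/funext => j; apply: eq_fsbigr => c /set_mem[cc _ ci].
by rewrite ceil_floor ut //= addrK.
Qed.

Lemma near_passes i t :
  uncut D i t -> \forall u \near t^', passes i u = passes i t.
Proof.
move=> ut; apply: near_left_right; last exact: near_passes_right.
by rewrite -(passes_uncut ut); exact: near_passes_left.
Qed.

(** [floor x - (ceil x - 1)] is 1 if [x] is an integer and 0 otherwise, and only
    the crossing [c] has its underpass at a lift of [c.2.2]. *)
Lemma passes_jump c k j : classical D c ->
  passes c.2.1 (c.2.2 + k%:~R) j =
  passes_left c.2.1 (c.2.2 + k%:~R) j + (if j == c.1.1 then writhe D c else 0).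
Proof.
move=> cc; pose J c' : int := if c' == c then writhe D c else 0.
have -> : (if j == c.1.1 then writhe D c else 0) =
    \sum_(c' \in crossings_over D j c.2.1) J c'.
  have [->|jc] := eqVneq.
    rewrite -(@fsbig_widen _ _ _ _ [set c]) ?fsbig_set1 /J ?eqxx //.
      by move=> _ ->.
    by move=> c' [_ /= /eqP/negPf ->].
  rewrite fsbig1 // => c' [_ c'j _]; rewrite /J.
  by case: eqP => // c'c; case/eqP: jc; rewrite -c'j c'c.
rewrite -fsbig_split; last exact: finite_crossings.
apply: eq_fsbigr => c' /set_mem[cc' _ ci].
rewrite /J; case: eqP => [->|/eqP nc].
  have -> : c.2.2 + k%:~R - c.2.2 = k%:~R :> R by rewrite addrC addKr.
  by rewrite intrKfloor intrKceil mulrBr mulr1 /= subrK.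
suff ni : c.2.2 + k%:~R - c'.2.2 \isn't a Num.int.
  by rewrite ceil_floor ni /= addrK addr0.
apply/negP=> /intrP[l cl]; case/eqP: nc; apply: over_unique => //.
have pair_inj (p q : 'I_mu * R) : p.1 = q.1 -> p.2 = q.2 -> p = q.
  by case: p q => [? ?] [? ?] /= -> ->.
apply: pair_inj => //; have [_ s01 _ _] := classical_double cc.
have [_ s'01 _ _] := classical_double cc'.
apply: (@shift_eq0 _ _ (k - l)) => //.
by rewrite rmorphB /= -cl opprB addrA [RHS]addrC subrK.
Qed.

Lemma passes_period i t j : passes i (t + 1) j = passes i t j + linking D j i.
Proof.
rewrite /linking -fsbig_split; last exact: finite_crossings.
apply: eq_fsbigr => c _; rewrite addrAC floorDrz ?rpred1 // floor1.
by rewrite mulrDr mulr1.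
Qed.

(** The writhe-weighted number of passages of [K_i] under [K_j] on the way from
    the base point to [t]. *)
Definition winding i t j : int := passes i t j - passes i (base i) j.

Lemma winding_base i j : winding i (base i) j = 0.
Proof. exact: subrr. Qed.

Lemma near_winding i t : uncut D i t ->
  \forall u \near t^', winding i u = winding i t.
Proof. by move=> /near_passes; apply: filterS => u ut; rewrite /winding ut. Qed.

Lemma winding_period i t :
  winding i (t + 1) = fun j => winding i t j + linking D j i.
Proof. by apply/funext => j; rewrite /winding passes_period addrAC. Qed.

Lemma winding_crossing c k : classical D c -> exists n,
  (\forall u \near (c.2.2 + k%:~R)^'-, winding c.2.1 u = n) /\
  (\forall u \near (c.2.2 + k%:~R)^'+, winding c.2.1 u =
     fun j => n j + (if j == c.1.1 then writhe D c else 0)).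
Proof.
move=> cc; exists (fun j => passes_left c.2.1 (c.2.2 + k%:~R) j
  - passes c.2.1 (base c.2.1) j); split.
  have := near_passes_left c.2.1 (c.2.2 + k%:~R).
  by apply: filterS => u uc; rewrite /winding uc.
have := near_passes_right c.2.1 (c.2.2 + k%:~R).
apply: filterS => u uc; apply/funext => j.
by rewrite /winding uc passes_jump // addrAC.
Qed.

(** The principle for walking along [K_i]: an invariant that survives every
    underpass is constant. *)
Lemma circle_constant i (T : Type) (F : R -> T) :
    (forall t, uncut D i t -> \forall u \near t^', F u = F t) ->
    (forall c k, classical D c -> c.2.1 = i -> exists v,
       (\forall u \near (c.2.2 + k%:~R)^'-, F u = v) /\
       (\forall u \near (c.2.2 + k%:~R)^'+, F u = v)) ->
  forall t u, uncut D i t -> uncut D i u -> F t = F u.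
Proof.
move=> Fu Fc; apply: punctured_constant => // t /not_uncut[c [k [cc ci ->]]].
by have [v [Fl Fr]] := Fc c k cc ci; exists v; apply: near_left_right.
Qed.

Lemma ex_arc_in c : exists a : arcs D, arc_in c a.
Proof. by have [a] := arc_left_limit c.2.1 c.2.2; exists a; apply/arc_inP. Qed.

Lemma ex_arc_out c : exists a : arcs D, arc_out c a.
Proof.
by have [a] := arc_right_limit c.2.1 c.2.2; exists a; apply/arc_outP.
Qed.

End Diagram.
Local Open Scope group_scope.

(** * Representations of the link group in class two groups *)

Section Representations.
Variables (R : realType) (mu : nat) (D : link_diagram R mu) (G : groupType).
Hypothesis G2 : class_two G.

Section Unwind.
Variable y : arcs D -> G.
Hypothesis y_rel : wirtinger y.

Let yb i := y (arc_at D i (base D i)).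

(** Passing an underpass replaces a meridian by a conjugate, which is the same
    modulo the centre. *)
Lemma meridian_same_conj i t :
  uncut D i t -> same_conj (y (arc_at D i t)) (yb i).
Proof.
move=> ut; pose F u := gconj (y (arc_at D i u)).
suff e : F t = F (base D i) by move=> v; rewrite -/(F t) e.
apply: (@circle_constant _ _ D i _ F) => //; last exact: base_uncut.
- by move=> u /arc_at_near; apply: filterS => v; rewrite /F => ->.
- move=> c k cc ci; subst i.
  have [a2 c2] := ex_arc_in D c; have [a3 c3] := ex_arc_out D c.
  have c1 : arc_over c (arc_at D c.1.1 c.1.2) by apply/arc_overP.
  exists (gconj (y a2)); split.
    by apply: filterS (near_left_shift k c2) => u; rewrite /F => ->.
  apply: filterS (near_right_shift k c3) => u; rewrite /F => ->; apply/funext.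
  by rewrite (y_rel cc c1 c2 c3); exact: same_conj_gconj.
Qed.

(** Both sides are conjugated by the same element at each underpass, so the
    truth value of the equality is an invariant of the walk, and it is true at
    the base point. *)
Lemma meridian_winding i t : uncut D i t ->
  y (arc_at D i t) = gconj (longitude yb i (winding D i t)) (yb i).
Proof.
move=> ut; pose F u :=
  y (arc_at D i u) = gconj (longitude yb i (winding D i u)) (yb i).
rewrite -/(F t); suff -> : F t = F (base D i).
  rewrite /F (_ : winding D i (base D i) = fun=> 0%R); last first.
    by apply/funext => j; exact: winding_base.
  by rewrite longitude0 gconj1.
apply: (@circle_constant _ _ D i _ F) => //; last exact: base_uncut.
- move=> u uu; apply: filterS2 (arc_at_near uu) (near_winding uu) => v.
  by rewrite /F => -> ->.
- move=> c k cc ci; subst i.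
  have [a2 c2] := ex_arc_in D c; have [a3 c3] := ex_arc_out D c.
  have c1 : arc_over c (arc_at D c.1.1 c.1.2) by apply/arc_overP.
  have [n [nl nr]] := winding_crossing k cc; rewrite /F.
  exists (y a2 = gconj (longitude yb c.2.1 n) (yb c.2.1)); split.
    by apply: filterS2 (near_left_shift k c2) nl => v -> ->.
  apply: filterS2 (near_right_shift k c3) nr => v -> ->.
  rewrite (y_rel cc c1 c2 c3) longitude_step //.
  rewrite (same_conj_expgz _ (meridian_same_conj (over_uncut cc))).
  by apply/propext; split=> [/(can_inj (gconjK _))|->].
Qed.

(** [meridian_winding] after one full turn, which returns to the base arc. *)
Lemma longitude_relation i :
  yb i = gconj (longitude yb i (linking D ^~ i)) (yb i).
Proof.
have u1 : uncut D i (base D i + 1%R) by apply/(uncutD _ _ _ 1%R)/base_uncut.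
have := meridian_winding u1;
rewrite (arc_at_shift D i (base D i) 1%R) -/(yb i) => {1}->.
congr (gconj (longitude _ _ _) _); apply/funext => j.
by rewrite winding_period winding_base add0r.
Qed.

End Unwind.

Section Wind.
Variable g : 'I_mu -> G.
Hypothesis g_rel : forall i, g i = gconj (longitude g i (linking D ^~ i)) (g i).

Let H i t := gconj (longitude g i (winding D i t)) (g i).

Let H_period i t k : H i (t + k%:~R)%R = H i t.
Proof.
have H1 u : H i (u + 1)%R = H i u.
  by rewrite /H winding_period longitudeD // gconjM -g_rel.
elim/int_rect: k => [|n IHn|n IHn]; first by rewrite addr0.
  by rewrite -addn1 PoszD rmorphD addrA /= H1.
rewrite -H1 -IHn; congr H.
by rewrite -(addn1 n) PoszD opprD rmorphD /= -!addrA addNr addr0.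
Qed.

Let H_arc i j t u : uncut D i t -> uncut D j u -> arc_at D i t = arc_at D j u ->
  H i t = H j u.
Proof.
move=> ut uu tu; have [ij [k tuk]] := arc_at_inj ut uu tu.
rewrite -{}ij in uu tu *.
rewrite -(H_period _ u k).
apply: (connected_locally_constant
  (@component_connected _ (uncut D i) t)) => //.
  move=> v /connected_component_sub uv; apply: near_punctured => //.
  by apply: filterS (near_winding uv) => w wv _; rewrite /H wv.
exact: connected_component_refl.
Qed.

(** The value at an arc is computed at any of its parameters: it is constant on
    connected components because the windings are, and periodic because of the
    hypothesis on the longitudes. *)
Lemma winding_wirtinger : exists y : arcs D -> G, wirtinger y /\
  forall i t, uncut D i t ->
    y (arc_at D i t) = gconj (longitude g i (winding D i t)) (g i).
Proof.
have /choice[y Hy] : forall a : arcs D, exists v,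
    forall i t, uncut D i t -> a = arc_at D i t -> v = H i t.
  move=> a; have [i [t [ut ->]]] := arcP a.
  by exists (H i t) => j u; apply: H_arc.
have {}Hy i t : uncut D i t -> y (arc_at D i t) = H i t by move=> ut; apply: Hy.
exists y; split=> // c a1 a2 a3 cc.
move=> /arc_overP-/(_ cc) -> /arc_inP c2 /arc_outP c3.
have [n []] := winding_crossing 0%R cc; rewrite addr0 => nl nr.
have [u [ul <- un]] : exists u,
    [/\ uncut D c.2.1 u, arc_at D c.2.1 u = a2 & winding D c.2.1 u = n].
  apply: (@filter_ex _ c.2.2^'-); near=> u; split; near: u => //.
  exact/near_left/near_uncut.
have [v [vl <- vn]] : exists v, [/\ uncut D c.2.1 v, arc_at D c.2.1 v = a3 &
    winding D c.2.1 v =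
      fun j => (n j + if j == c.1.1 then writhe D c else 0)%R].
  apply: (@filter_ex _ c.2.2^'+); near=> v; split; near: v => //.
  exact/near_right/near_uncut.
rewrite !Hy //; last exact: over_uncut.
rewrite {1}/H vn longitude_step // -un; apply/esym.
by apply: same_conj_expgz; exact: same_conj_gconj.
Unshelve. all: by end_near. Qed.

End Wind.

End Representations.

(** * The presentation *)

Theorem corollary23 (R : realType) (mu : nat) (D : link_diagram R mu) :
  let G := link_group D in
  let g : 'I_mu -> free_group 'I_mu := @free_gen 'I_mu in
  let W (i : 'I_mu) := \prod_(j < mu | j != i) expgz (g j) (linking D j i) in
  has_presentation (quotient_group (lcs_nsub G 3))
    ([set r | exists i : 'I_mu, r = (g i, W i * g i * (W i)^-1)] `|`
     [set r | exists i j k : 'I_mu, r = (comm (g i) (comm (g j) (g k)), 1)]).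
Proof.
move=> G g W; set rels := (_ `|` _).
pose Q := quotient_group (lcs_nsub G 3).
have Q2 : class_two Q by exact: quotient_lcs3.
pose q : UMagmaMorphism.type G Q := quotient_proj (lcs_nsub G 3).
pose y a : Q := q (presented_gen _ a).
have y_rel : wirtinger y.
  have /wirtingerP : forall r, @link_rels R mu D r ->
      (q \o presented_proj _ : UMagmaMorphism.type _ _) r.1 =
      q (presented_proj _ r.2).
    by move=> r rr; exact: (congr1 q (presented_rel rr)).
  exact.
pose yb i := y (arc_at D i (base D i)).
have [f fE] := free_lift yb.
have fW i : f (W i) = longitude yb i (linking D ^~ i).
  by rewrite -/(longitude g i _) gmulf_longitude; congr longitude; apply/funext.
have [phi phiE] : exists phi : UMagmaMorphism.type (presented_group rels) Q,
    forall i, phi (presented_gen rels i) = yb i.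
  have [_ [[i ->]|[i [j [k ->]]]]|phi phiE] := @presented_lift _ rels _ f.
  - rewrite /= -/(gconj (W i) (g i)) gmulf_gconj fW fE.
    exact: longitude_relation.
  - by rewrite /= !gmulf_comm gmulf1; exact: Q2.
  - by exists phi => i; rewrite phiE.
pose P := presented_group rels.
pose p : UMagmaMorphism.type _ P := presented_proj rels.
have P2 : class_two P.
  apply: (@generated_class_two _ _ (presented_gen rels)).
    exact: presented_ind.
  move=> i j k; have <- : p 1 = 1 by exact: gmulf1.
  have e : p (comm (g i) (comm (g j) (g k))) =
      comm (p (g i)) (comm (p (g j)) (p (g k))) by rewrite 2!gmulf_comm.
  apply: etrans (esym e) _.
  by apply: (@presented_rel _ rels (_, _)); right; exists i, j, k.
pose pg i : P := presented_gen rels i.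
have pg_rel i : pg i = gconj (longitude pg i (linking D ^~ i)) (pg i).
  have := @presented_rel _ rels (_, _) (or_introl (ex_intro _ i erefl)).
  rewrite /= -/(gconj (W i) (g i)) gmulf_gconj -/(longitude g i _).
  by rewrite gmulf_longitude.
have [z [z_rel zE]] := winding_wirtinger P2 pg_rel.
have [h hE] := free_lift z.
have [psi0 psi0E] : exists psi0 : UMagmaMorphism.type G P,
    forall a, psi0 (presented_gen _ a) = z a.
  have [|psi psiE] := @presented_lift _ (@link_rels R mu D) _ h.
    by apply/wirtingerP => c a1 a2 a3 ? ? ? ?; rewrite !hE; exact: z_rel.
  by exists psi => a; rewrite psiE.
have [psi psiE] : exists psi : UMagmaMorphism.type Q P,
    forall x, psi (q x) = psi0 x.
  by apply: quotient_lift => x; exact: lcs3_ker.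
exists phi; exists psi.
- apply: (@presented_ext _ rels P (psi \o phi) idfun) => i.
  rewrite [LHS](congr1 psi (phiE i)) [LHS]psiE psi0E zE; last exact: base_uncut.
  rewrite (_ : winding D i _ = fun=> 0%R) ?longitude0 ?gconj1 //.
  by apply/funext => j; exact: winding_base.
- move=> b; rewrite -(quotient_reprK b) [psi _]psiE.
  apply: (@presented_ext _ (@link_rels R mu D) Q (phi \o psi0) q) => a.
  have [i [t [ut ->]]] := arcP a; rewrite /= psi0E zE // gmulf_gconj.
  rewrite gmulf_longitude phiE (_ : (fun j => phi (pg j)) = yb).
    by rewrite -meridian_winding.
  by apply/funext => j; exact: phiE.
Qed.
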